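(* Let $D\geq1$ be a natural number and let $\mathfrak{X}=[0,1]^D$ be the unit cube in dimension $D$, endowed with the $\ell^\infty$ metric $d$ and its Borel $\sigma$-field, and let $\mu$ be an absolutely continuous probability measure on $\mathfrak{X}$ with density $f$ satisfying $c\leq f(x)\leq C$ for every $x\in\mathfrak{X}$, where $0<c\leq C<\infty$. Given $\alpha\in(0,\infty)$, let $$r(n)\equiv r(n,D,c,\alpha):=c^{-1/D}(4\cdot3^{D-1})^{1/D}(2+\alpha)^{1/(2D)}\left(\frac{\ln n}{n}\right)^{1/(2D)}.$$ Then there exists $n_0\equiv n_0(D,c,C,\alpha)$, depending only on $D$, $c$, $C$, $\alpha$, such that for every $n\geq n_0$, the space $(\mathfrak{X},d,\mu)$ is $(n,n^{-\alpha},r(n))$-disintegrable.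
   Context: $\mathbb{N}=\{1,2,\dots\}$ and $[n]=\{1,\dots,n\}$. A metric Polish probability space $(\mathfrak{X},d,\mu)$ consists of a Polish space $\mathfrak{X}$, a (not necessarily complete) metric $d$ generating its topology, and a Borel probability measure $\mu$. $B(x,r)=\{y\in\mathfrak{X}: d(x,y)\leq r\}$ is the closed ball. Given $n\in\mathbb{N}$, $\epsilon>0$, $r>0$, $(\mathfrak{X},d,\mu)$ is $(n,\epsilon,r)$-disintegrable if, whenever $X_1,\dots,X_n$ are i.i.d. with distribution $\mu$ on a probability space $(\Psi,\mathcal{F},\mathbb{P})$, with $\mathbb{P}$-probability at least $1-\epsilon$ (i.e. on some event of probability at least $1-\epsilon$) there exists a disintegration of $\mu$ along the random multifunction $x\mapsto\{i\in[n]: x\in B(X_i,r)\}$ with respect to the uniform measure on $[n]$; that is, there exist Borel probability measures $\mu_1,\dots,\mu_n$ on $\mathfrak{X}$ with $\mu_i(B(X_i,r))=1$ for all $i$ and $\mu=\frac1n\sum_{i=1}^n\mu_i$. *)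

(* Defs.v *)
From HB Require Import structures.
From mathcomp Require Import all_boot all_order all_algebra.
From mathcomp Require Import all_classical all_reals all_analysis.

Set Implicit Arguments.
Unset Strict Implicit.
Unset Printing Implicit Defensive.

Import Order.TTheory GRing.Theory Num.Theory.
Import numFieldNormedType.Exports.

Local Open Scope classical_set_scope.
Local Open Scope ring_scope.

#[short(type="pmetricType")]
HB.structure Definition PointedMetric (K : numDomainType) :=
  {T of Metric K T & Pointed T}.

Notation borel T := (g_sigma_algebraType (@open T)).

Section disintegrable.
Context (R : realType).

(* Not the library's [closed_ball], which is the closure of the open ball and
   may be strictly smaller in a general metric space. *)
Definition cball (T : metricType R) (x : T) (r : R) : set T :=
  [set y | mdist x y <= r].

Definition mutually_independent d d' (Psi : measurableType d)
    (T : measurableType d') (P : probability Psi R) (n : nat)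
    (X : 'I_n -> {RV P >-> T}) : Prop :=
  forall (J : {set 'I_n}) (A : 'I_n -> set T), (forall i, measurable (A i)) ->
    P (\bigcap_(i in [set` J]) (X i @^-1` A i)) =
    (\prod_(i in J) P (X i @^-1` A i))%E.

Definition iid_with_law d d' (Psi : measurableType d) (T : measurableType d')
    (P : probability Psi R) (mu : probability T R) (n : nat)
    (X : 'I_n -> {RV P >-> T}) : Prop :=
  mutually_independent X /\
  forall i A, measurable A -> distribution P (X i) A = mu A.

Definition ball_disintegration (T : pmetricType R)
    (mu : probability (borel T) R) (n : nat) (x : 'I_n -> T) (r : R)
    (nu : 'I_n -> probability (borel T) R) : Prop :=
  (forall i, nu i (cball (x i) r) = 1%E) /\
  (forall A : set (borel T), measurable A ->
     mu A = (n%:R^-1%:E * \sum_(i < n) nu i A)%E).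

(* Completeness and separability of [T] play no role here, so the notion is
   stated for an arbitrary metric space.  The good event is any measurable [E]
   included in the set of outcomes admitting a disintegration; the latter set
   is not required to be measurable. *)
Definition disintegrable (T : pmetricType R) (mu : probability (borel T) R)
    (n : nat) (eps r : R) : Prop :=
  forall (d : measure_display) (Psi : measurableType d)
         (P : probability Psi R) (X : 'I_n -> {RV P >-> borel T}),
    iid_with_law mu X ->
    exists E : set Psi, [/\ measurable E, ((1 - eps)%:E <= P E)%E &
      forall w, E w ->
        exists nu, ball_disintegration mu (fun i => X i w : T) r nu].

End disintegrable.

Section lebesgue_tuple.
Context (R : realType).
Let RR : measurableType _ := measurableTypeR R.

Definition tuple_cons (n : nat) (p : RR * n.-tuple RR) : n.+1.-tuple RR :=
  [tuple of p.1 :: p.2].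

Lemma measurable_tuple_cons n : measurable_fun setT (@tuple_cons n).
Proof. exact: measurable_cons. Qed.

Section step.
Context (n : nat) (m : {sigma_finite_measure set (n.-tuple RR) -> \bar R}).

Definition lebesgue_cons : set (n.+1.-tuple RR) -> \bar R :=
  pushforward (@lebesgue_measure R \x m)%E (@tuple_cons n).

Let lebesgue_cons0 : lebesgue_cons set0 = 0%E.
Proof. by rewrite /lebesgue_cons /pushforward preimage_set0 measure0. Qed.

Let lebesgue_cons_ge0 A : (0 <= lebesgue_cons A)%E.
Proof. by rewrite /lebesgue_cons /pushforward measure_ge0. Qed.

Let lebesgue_cons_sigma_additive : semi_sigma_additive lebesgue_cons.
Proof.
apply: (@measure_semi_sigma_additive _ _ _ (pushforward _ _)).
exact: measurable_tuple_cons.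
Qed.

HB.instance Definition _ := isMeasure.Build _ _ _ lebesgue_cons
  lebesgue_cons0 lebesgue_cons_ge0 lebesgue_cons_sigma_additive.

Lemma lebesgue_cons_sigma_finite : sigma_finite setT lebesgue_cons.
Proof.
have /sigma_finiteP[F [TF ndF Foo]] := sigma_finiteT (@lebesgue_measure R).
have /sigma_finiteP[G [TG ndG Goo]] := sigma_finiteT m.
pose g (t : n.+1.-tuple RR) : RR * n.-tuple RR := (thead t, [tuple of behead t]).
have mg : measurable_fun setT g.
  apply: measurable_fun_pair; first exact: measurable_tnth.
  exact: measurable_behead.
have gK : g \o @tuple_cons n = id.
  apply/funext => -[x t]; rewrite /g/=; congr (_, _).
  exact: val_inj.
exists (fun k => g @^-1` (F k `*` G k)).
  rewrite -preimage_bigcup -[LHS](preimage_setT g); congr (_ @^-1` _).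
  apply/esym/seteqP; split => // -[x t] _.
  have [i _ Fi] : (\bigcup_i F i) x by rewrite -TF.
  have [k _ Gk] : (\bigcup_i G i) t by rewrite -TG.
  exists (maxn i k) => //; split => /=.
  - by move: x Fi; exact/subsetPset/ndF/leq_maxl.
  - by move: t Gk; exact/subsetPset/ndG/leq_maxr.
move=> k; have [[mF Fk] [mG Gk]] := (Foo k, Goo k); split.
  by rewrite -[X in measurable X]setTI; apply: mg => //; exact: measurableX.
rewrite /lebesgue_cons /pushforward -comp_preimage gK preimage_id.
by rewrite product_measure1E// lte_mul_pinfty// ge0_fin_numE.
Qed.

HB.instance Definition _ := @Measure_isSigmaFinite.Build _ _ _ lebesgue_cons
  lebesgue_cons_sigma_finite.

End step.

Fixpoint lebesgue_tuple (n : nat) :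
    {sigma_finite_measure set (n.-tuple RR) -> \bar R} :=
  if n is n'.+1 then lebesgue_cons (lebesgue_tuple n')
  else @dirac _ (0.-tuple RR) [tuple] R.

Definition tuple_row (n : nat) (t : n.-tuple RR) : borel 'rV[R]_n :=
  \row_j tnth t j.

Lemma measurable_tuple_row (n : nat) :
  measurable_fun setT (@tuple_row n).
Proof.
apply: (@measurability _ _ _ (borel 'rV[R]_n) _ _ (@open 'rV[R]_n)) => //.
move=> _ [U oU <-]; rewrite setTI.
pose B (p : 'rV[rat]_n * nat) : set 'rV[R]_n :=
  ball (map_mx ratr p.1 : 'rV[R]_n) p.2.+1%:R^-1.
have -> : U = \bigcup_p (if `[< B p `<=` U >] then B p else set0).
  apply/seteqP; split => [x Ux|x [p _]]; last first.
    by case: asboolP => // pU; exact: pU.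
  have /nbhs_ballP[e /= e0 xeU] : nbhs x U by exact: open_nbhs_nbhs.
  have e20 : 0 < e / 2 by rewrite divr_gt0.
  have [k _ /(_ k (leqnn k)) /= ke] := near_infty_natSinv_lt (PosNum e20).
  have k0 : 0 < k.+1%:R^-1 :> R by rewrite invr_gt0.
  have /choice[q xq] : forall j, exists q : rat,
      `|ratr q - x ord0 j| < k.+1%:R^-1.
    move=> j; have [|q] := @rat_in_itvoo R (x ord0 j - k.+1%:R^-1)
      (x ord0 j + k.+1%:R^-1); first by rewrite ltrD2l gtrN.
    by rewrite in_itv/= => qx; exists q; rewrite ltr_distl.
  exists (\row_j q j, k) => //; have Bx : B (\row_j q j, k) x.
    by split => //= i j; rewrite ord1 !mxE/=; exact: xq.
  case: asboolP => // -[] y By; apply: xeU.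
  apply: (@le_ball _ _ _ (k.+1%:R^-1 + k.+1%:R^-1)).
    by rewrite (splitr e) ltW// ltrD.
  exact: ball_triangle (ball_sym Bx) By.
rewrite preimage_bigcup; apply: countable_bigcupT_measurable => // p.
case: asboolP => _; last by rewrite preimage_set0.
have -> : @tuple_row n @^-1` B p =
    \bigcap_j ((fun t : n.-tuple RR => tnth t j) @^-1`
      ball (ratr (p.1 ord0 j) : R) p.2.+1%:R^-1).
  apply/seteqP; split => [t [_ tp] j _|t tp].
    by have := tp ord0 j; rewrite !mxE.
  by split => [|i j]; rewrite ?invr_gt0// ord1 !mxE; exact: tp.
apply: fin_bigcap_measurable => [|j _]; first exact: finite_finset.
rewrite -[X in measurable X]setTI; apply: measurable_tnth => //.
exact: measurable_realfun.measurable_ball.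
Qed.

(* Lebesgue measure on R^n: the n-fold product of the library's one-dimensional
   Lebesgue measure, transported from tuples to row vectors. *)
Definition lebesgue_rV (n : nat) : set (borel 'rV[R]_n) -> \bar R :=
  pushforward (lebesgue_tuple n) (@tuple_row n).

Section measure.
Variable n : nat.

Let lebesgue_rV0 : @lebesgue_rV n set0 = 0%E.
Proof. by rewrite /lebesgue_rV /pushforward preimage_set0 measure0. Qed.

Let lebesgue_rV_ge0 A : (0 <= @lebesgue_rV n A)%E.
Proof. by rewrite /lebesgue_rV /pushforward measure_ge0. Qed.

Let lebesgue_rV_sigma_additive : semi_sigma_additive (@lebesgue_rV n).
Proof.
apply: (@measure_semi_sigma_additive _ _ _ (pushforward _ _)).
exact: measurable_tuple_row.
Qed.

HB.instance Definition _ := isMeasure.Build _ _ _ (@lebesgue_rV n)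
  lebesgue_rV0 lebesgue_rV_ge0 lebesgue_rV_sigma_additive.

End measure.

Lemma lebesgue_rV_box (n : nat) (a b : 'I_n -> R) : (forall j, a j <= b j) ->
  lebesgue_rV [set x : 'rV[R]_n | forall j, a j <= x ord0 j <= b j] =
  (\prod_(j < n) (b j - a j))%:E.
Proof.
have box_itv m (u v : 'I_m -> R) :
    [set t : m.-tuple RR | forall j, u j <= tnth t j <= v j] =
    \bigcap_j ((fun t : m.-tuple RR => tnth t j) @^-1` `[u j, v j]).
  apply/seteqP; split=> [t tab j _ /=|t tab j]; first by rewrite in_itv/= tab.
  by have := tab j I; rewrite /= in_itv.
have mbox m (u v : 'I_m -> R) :
    measurable [set t : m.-tuple RR | forall j, u j <= tnth t j <= v j].
  rewrite box_itv; apply: fin_bigcap_measurable => [|j _].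
    exact: finite_finset.
  rewrite -[X in measurable X]setTI; apply: measurable_tnth => //.
rewrite /lebesgue_rV /pushforward.
rewrite (_ : _ @^-1` _ = [set t | forall j, a j <= tnth t j <= b j]); last first.
  by apply/seteqP; split=> t tab j; have := tab j; rewrite /= mxE.
elim: n a b => [a b _|n IH a b ab] /=.
  by rewrite big_ord0 diracE mem_set// => -[].
rewrite /lebesgue_cons /pushforward.
rewrite (_ : _ @^-1` _ = `[a ord0, b ord0] `*`
    [set t | forall j, a (lift ord0 j) <= tnth t j <= b (lift ord0 j)]); last first.
  apply/seteqP; split=> [[x t] tab|[x t] [/= xab tab] j]; first split.
  - by have := tab ord0; rewrite /= in_itv.
  - by move=> j; have := tab (lift ord0 j); rewrite /= tnthS.
  - case: (unliftP ord0 j) => [k|] ->; first by rewrite tnthS.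
    by move: xab; rewrite in_itv.
rewrite product_measure1E//; last exact: mbox.
rewrite IH// [X in (X * _)%E]lebesgue_measure_itv/= lte_fin big_ord_recl EFinM.
case: ltP => // ba; congr (_ * _)%E.
have /eqP -> : a ord0 == b ord0 by rewrite eq_le ab ba.
by rewrite subrr.
Qed.

End lebesgue_tuple.

Section unit_cube.
Context (R : realType) (D : nat).

Definition cube_set : set 'rV[R]_D := [set x : 'rV[R]_D | forall j, 0 <= x ord0 j <= 1].

Definition unit_cube : Type := set_type cube_set.

HB.instance Definition _ := PseudoMetric.on unit_cube.

Lemma cube_set0 : 0 \in cube_set.
Proof. by rewrite inE => j; rewrite mxE lexx ler01. Qed.

HB.instance Definition _ :=
  isPointed.Build unit_cube (exist (fun x => x \in cube_set) 0 cube_set0).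

(* The norm of 'rV[R]_D is mx_norm, i.e. the sup norm, so this is the
   l^infinity metric. *)
Definition cube_dist (x y : unit_cube) : R := `|val x - val y|.

Let cube_dist_ge0 x y : 0 <= cube_dist x y.
Proof. exact: normr_ge0. Qed.

Let cube_dist_positivity x y : cube_dist x y = 0 -> x = y.
Proof. by move/eqP; rewrite normr_eq0 subr_eq0 => /eqP/val_inj. Qed.

Let cube_ballE x e : ball x e = [set y | cube_dist x y < e].
Proof.
by apply/seteqP; split => y; rewrite /ball/= /initial_ball /= mx_norm_ball.
Qed.

HB.instance Definition _ := PseudoMetric_isMetric.Build R unit_cube
  cube_dist_ge0 cube_dist_positivity cube_ballE.

End unit_cube.

Arguments cube_set : clear implicits.

Section lebesgue_cube.
Context (R : realType) (D : nat).
Local Notation X := (borel (unit_cube R D)).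

Lemma measurable_cube_set : measurable (cube_set R D : set (borel 'rV[R]_D)).
Proof.
rewrite -[cube_set R D]setCK; apply: measurableC; apply: sub_sigma_algebra.
rewrite openC.
rewrite (_ : cube_set R D = \bigcap_j
    ((fun x : 'rV[R]_D => x ord0 j) @^-1` `[0, 1]%classic)); last first.
  apply/seteqP; split=> [x xab j _ /=|x xab j]; first by rewrite in_itv/= xab.
  by have := xab j I; rewrite /= in_itv.
apply: closed_bigI => j _; apply: preimage_closed.
  by move=> ? _; exact: coord_continuous.
exact: interval_closed.
Qed.

Definition cube_val (x : X) : borel 'rV[R]_D := val x.

Lemma cube_val_inj : injective cube_val.
Proof. exact: val_inj. Qed.

Lemma range_cube_val : range cube_val = cube_set R D.
Proof.
apply/seteqP; split=> [_ [x _ <-]|x xC]; first by have := valP x; rewrite inE.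
by exists (exist (fun x => x \in cube_set R D) x (mem_set xC)).
Qed.

Lemma measurable_image_cube (A : set X) :
  measurable A -> measurable (cube_val @` A).
Proof.
suff : <<s @open (unit_cube R D) >> `<=`
    [set A : set X | measurable (cube_val @` A)] by exact.
apply: smallest_sub => [|U oU].
  split => [|B mB|F mF] /=.
  - by rewrite image_set0.
  - rewrite (_ : _ @` _ = range cube_val `\` cube_val @` B).
      rewrite range_cube_val; apply: measurableD => //.
      exact: measurable_cube_set.
    apply/seteqP; split => [_ [x [_ nBx] <-]|_ [[x _ <-] nBx]].
      by split; [exists x|move=> [y By /cube_val_inj yx]; apply: nBx; rewrite -yx].
    by exists x => //; split => // Bx; apply: nBx; exists x.
  - by rewrite image_bigcup; exact: bigcupT_measurable.
have [V oV VU] := oU.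
rewrite /= (_ : _ @` _ = V `&` cube_set R D); last first.
  rewrite -range_cube_val -VU; apply/seteqP; split => [_ [x Ux <-]|y [Vy [x _ xy]]].
    by split => //; exists x.
  by exists x => //; rewrite /= -xy in Vy.
apply: measurableI; last exact: measurable_cube_set.
exact: sub_sigma_algebra.
Qed.

Definition lebesgue_cube (A : set X) : \bar R := lebesgue_rV (cube_val @` A).

Let lebesgue_cube0 : lebesgue_cube set0 = 0%E.
Proof. by rewrite /lebesgue_cube image_set0 measure0. Qed.

Let lebesgue_cube_ge0 A : (0 <= lebesgue_cube A)%E.
Proof. exact: measure_ge0. Qed.

Let lebesgue_cube_sigma_additive : semi_sigma_additive lebesgue_cube.
Proof.
move=> F mF tF mUF; rewrite /lebesgue_cube image_bigcup.
apply: measure_semi_sigma_additive.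
- by move=> k; exact: measurable_image_cube.
- move=> i j _ _ [_ [[x Fx <-] [y Fy /cube_val_inj yx]]].
  by apply: tF => //; exists x; split => //; rewrite -yx.
- by rewrite -image_bigcup; exact: measurable_image_cube.
Qed.

HB.instance Definition _ := isMeasure.Build _ _ _ lebesgue_cube
  lebesgue_cube0 lebesgue_cube_ge0 lebesgue_cube_sigma_additive.

Lemma lebesgue_cubeT : lebesgue_cube setT = 1%E.
Proof.
rewrite /lebesgue_cube range_cube_val.
rewrite (@lebesgue_rV_box R D (fun=> 0) (fun=> 1)); last by move=> _; exact: ler01.
by rewrite subr0 big1.
Qed.

Definition has_density (mu : probability X R) (f : X -> R) : Prop :=
  measurable_fun setT f /\
  forall A, measurable A -> mu A = (\int[lebesgue_cube]_(x in A) (f x)%:E)%E.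

End lebesgue_cube.

Definition disintegration_radius (R : realType) (D : nat) (c alpha : R) (n : nat) : R :=
  c `^ (- D%:R^-1) * (4 * 3 ^+ (D - 1)) `^ (D%:R^-1) *
  (2 + alpha) `^ ((2 * D%:R)^-1) * (ln n%:R / n%:R) `^ ((2 * D%:R)^-1).

(* Main.v *)
Require Import Defs.
From HB Require Import structures.
From mathcomp Require Import all_boot all_order all_algebra.
From mathcomp Require Import all_classical all_reals all_analysis.
From mathcomp Require Import ring lra zify.

Set Implicit Arguments.
Unset Strict Implicit.
Unset Printing Implicit Defensive.

Import Order.TTheory GRing.Theory Num.Theory.
Import numFieldNormedType.Exports.

Local Open Scope classical_set_scope.
Local Open Scope ring_scope.

(** Why the theorem holds.  Cut the cube into [m ^ D] congruent cells of side
    [1 / m], with [2 / m <= r], and number them along a snake, so that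
    consecutive cells touch.  Two points whose cell numbers differ by at most
    one are then within [2 / m <= r] of each other, and it suffices to move the
    empirical measure of the sample onto [mu] by shifting mass between
    consecutive cells only.

    On a path the flow that does this is forced: across the boundary after the
    first [k] cells one has to move the difference [g k] between the empirical
    mass and the [mu]-mass of these [k] cells.  Such a flow can be carried out
    in a single step as soon as every [|g k|] is at most the [mu]-mass of any
    cell ([tridiagonal_transport]).  A point in cell [k] which sends the
    fraction [a] of its mass to cell [l] then contributes [a] times [mu]
    conditioned on cell [l] to its own [nu i] ([path_disintegration]).

    The mass of a cell is at least [c (r / 3) ^ D] because [1 / m > r / 3] when
    [r < 1], and the radius is chosen so that this is [4 / 3 * t], where
    [n * t ^ 2 = (2 + alpha) * ln n].  So it remains to bound, for the
    [m ^ D] proper initial segments of the path, the probability that the sample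
    frequency deviates from the [mu]-mass by more than [t].  Chernoff's bound
    gives at most [2 exp (- n t ^ 2) = 2 n ^ (- 2 - alpha)] for each of them
    ([hits_deviation]), and the number of cells is at most [sqrt n], which
    yields a total below [n ^ (- alpha)].  All this works from [n = 2] on.  When
    [r >= 1] every ball is the whole cube and [nu i = mu] will do. *)

(** * Chernoff's bound *)

(** Comparing [expR x] with [(1 - x / 4) ^- 4], which dominates it because
    [1 + y <= expR y], reduces the claim to a polynomial inequality.  The
    coefficient 1 of [x ^+ 2] matters: it gives the exponent [n t ^ 2] below. *)
Lemma expR_le_quadratic (R : realType) (x : R) :
  `|x| <= 2^-1 -> expR x <= 1 + x + x ^+ 2.
Proof.
rewrite ler_norml => /andP[xl xu].
have q0 : 0 < 1 - x / 4 by lra.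
have e4 : expR x = (expR (- (x / 4)) ^+ 4)^-1.
  by rewrite -expRM_natl -expRN; congr expR; lra.
have e1 : (1 - x / 4) ^+ 4 <= expR (- (x / 4)) ^+ 4.
  by apply: lerXn2r; rewrite ?nnegrE ?expR_ge0 ?expR_ge1Dx//; exact: ltW.
rewrite e4; apply: (@le_trans _ _ ((1 - x / 4) ^+ 4)^-1).
  by rewrite lef_pV2 ?posrE ?exprn_gt0 ?expR_gt0.
rewrite -[_^-1]mul1r ler_pdivrMr ?exprn_gt0//.
have -> : (1 + x + x ^+ 2) * (1 - x / 4) ^+ 4 = 1 + x ^+ 2 *
    (3 / 8 - 11 / 16 * x + 81 / 256 * x ^+ 2 - 15 / 256 * x ^+ 3 + x ^+ 4 / 256).
  by field.
rewrite lerDl.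
apply: mulr_ge0; first exact: sqr_ge0.
have h1 : 0 <= x ^+ 2 * (81 - 15 * x) by rewrite mulr_ge0 ?sqr_ge0//; lra.
have h2 : 0 <= (x ^+ 2) ^+ 2 := sqr_ge0 _.
lra.
Qed.

(** The sum is the probability that a binomial variable exceeds its mean by
    more than [n t], written over the random set [J] of successes.  Exponential
    tilting with parameter [2 t] (the optimal one for the variance bound
    [p (1 - p) <= 1 / 4]) bounds it; the restriction on [t] keeps the exponents
    within the range of [expR_le_quadratic]. *)
Lemma binomial_chernoff (R : realType) (n : nat) (p t : R) :
  0 <= p <= 1 -> 0 <= t <= 4^-1 ->
  \sum_(J : {set 'I_n} | n%:R * (p + t) < #|J|%:R)
    \prod_i (if i \in J then p else 1 - p) <= expR (- (n%:R * t ^+ 2)).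
Proof.
move=> /andP[p0 p1] /andP[t0 t1].
pose u := 2 * t.
(* factors by which tilting reweights a success and a failure *)
pose a := expR (u * (1 - p)); pose b := expR (- (u * p)).
have w0 (J : {set 'I_n}) : 0 <= \prod_i (if i \in J then p else 1 - p).
  by apply: prodr_ge0 => i _; case: ifP; rewrite ?subr_ge0.
have tilt (J : {set 'I_n}) : \prod_i (if i \in J then p * a else (1 - p) * b) =
    expR (u * (#|J|%:R - n%:R * p)) * \prod_i (if i \in J then p else 1 - p).
  have -> : expR (u * (#|J|%:R - n%:R * p)) =
      \prod_(i < n) (if i \in J then a else b).
    rewrite /a /b.
    transitivity (\prod_(i < n) expR (u * ((i \in J)%:R - p))).
      have cardE : #|J|%:R = \sum_(i < n) (i \in J)%:R :> R.
        transitivity (\sum_(i in J) 1 : R); first by rewrite sumr_const.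
        by rewrite big_mkcond; apply: eq_bigr => i _; case: ifP.
      by rewrite -expR_sum -mulr_sumr sumrB sumr_const card_ord mulr_natl cardE.
    by apply: eq_bigr => i _; case: ifP => _; rewrite ?mulrBr// mulr0 sub0r.
  by rewrite -big_split; apply: eq_bigr => i _ /=; case: ifP => _; rewrite mulrC.
apply: (@le_trans _ _ (\sum_(J : {set 'I_n}) expR (- (n%:R * (u * t))) *
    \prod_i (if i \in J then p * a else (1 - p) * b))).
  rewrite [leRHS](bigID (fun J : {set 'I_n} => n%:R * (p + t) < #|J|%:R)) /=.
  rewrite -[leLHS]addr0 lerD//; last first.
    by apply: sumr_ge0 => J _; rewrite tilt !mulr_ge0 ?expR_ge0.
  apply: ler_sum => J Jt; rewrite tilt mulrA -expRD -[leLHS]mul1r.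
  apply: ler_wpM2r => //; rewrite -[leLHS]expR0 ler_expR.
  rewrite [X in _ <= X](_ : _ = u * (#|J|%:R - n%:R * (p + t))); last by ring.
  by apply: mulr_ge0; [rewrite /u mulr_ge0|rewrite subr_ge0 ltW].
rewrite -mulr_sumr.
have -> : \sum_(J : {set 'I_n}) \prod_i (if i \in J then p * a else (1 - p) * b) =
   (p * a + (1 - p) * b) ^+ n.
  rewrite -[in RHS](card_ord n) -prodr_const bigA_distr.
  by apply: eq_bigl => J; rewrite inE.
have a0 : a <= 1 + u * (1 - p) + (u * (1 - p)) ^+ 2.
  by apply: expR_le_quadratic; rewrite /u ler_norml; apply/andP; split; nra.
have b0 : b <= 1 + - (u * p) + (- (u * p)) ^+ 2.
  by apply: expR_le_quadratic; rewrite /u ler_norml; apply/andP; split; nra.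
have ab : p * a + (1 - p) * b <= expR (t ^+ 2).
  apply: le_trans (expR_ge1Dx _).
  have h1 := ler_wpM2l p0 a0.
  have h2 : (1 - p) * b <= (1 - p) * (1 + - (u * p) + (- (u * p)) ^+ 2).
    by apply: ler_wpM2l b0; rewrite subr_ge0.
  apply: le_trans (lerD h1 h2) _.
  rewrite [leLHS](_ : _ = 1 + 4 * t ^+ 2 * (p * (1 - p))); last by rewrite /u; ring.
  rewrite lerD2l.
  have : p * (1 - p) <= 4^-1 by have := sqr_ge0 (p - 2^-1); nra.
  by have := sqr_ge0 t; nra.
have ab0 : 0 <= p * a + (1 - p) * b.
  by rewrite addr_ge0 ?mulr_ge0 ?expR_ge0 ?subr_ge0.
have : (p * a + (1 - p) * b) ^+ n <= expR (n%:R * t ^+ 2).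
  by rewrite expRM_natl; apply: lerXn2r; rewrite ?nnegrE ?expR_ge0.
move=> /(ler_wpM2l (expR_ge0 (- (n%:R * (u * t))))) /le_trans; apply.
by rewrite -expRD ler_expR /u; lra.
Qed.

(** * Transport along a path *)

(** With [g k] the surplus of [s] over [p] among the first [k] sites, site [k]
    sends the positive part of [g k.+1] to its successor, the negative part of
    [g k] to its predecessor, and keeps the rest.  What it keeps is also
    [p k - (g k.+1)^- - (g k)^+]; it is nonnegative by [t <= p k] if at most one
    of these two parts is nonzero, and otherwise it is equal to [s k]. *)
Lemma tridiagonal_transport (R : realDomainType) (M : nat) (s p : nat -> R) (t : R) :
  (forall k, 0 <= s k) -> (forall k, (k < M)%N -> t <= p k) ->
  \sum_(k < M) s k = \sum_(k < M) p k ->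
  (forall k, (k < M)%N -> `|\sum_(j < k) s j - \sum_(j < k) p j| <= t) ->
  exists b : nat -> nat -> R,
    [/\ forall k l, (k < M)%N -> 0 <= b k l,
        forall k, (k < M)%N -> \sum_(l < M) b k l = s k,
        forall l, (l < M)%N -> \sum_(k < M) b k l = p l &
        forall k l, b k l != 0 -> (k <= l.+1)%N && (l <= k.+1)%N].
Proof.
move=> s0 tp spM spt.
pose g k := \sum_(j < k) s j - \sum_(j < k) p j.
have g0 : g 0 = 0 by rewrite /g !big_ord0 subrr.
have gM : g M = 0 by rewrite /g spM subrr.
have gS k : g k.+1 = g k + s k - p k by rewrite /g !big_ord_recr/=; ring.
pose pos x : R := Num.max x 0; pose neg x : R := Num.max (- x) 0.
have pos_ge0 x : 0 <= pos x by rewrite le_max lexx orbT.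
have neg_ge0 x : 0 <= neg x by rewrite le_max lexx orbT.
have posN x : pos x - neg x = x.
  by rewrite /pos /neg; case: (ltP x 0) => h; case: (ltP (- x) 0); lra.
pose d k := p k - neg (g k.+1) - pos (g k).
have dE k : d k = s k - pos (g k.+1) - neg (g k).
  by rewrite /d; have := gS k; have := posN (g k); have := posN (g k.+1); lra.
have t0 : (0 < M)%N -> 0 <= t by move=> M0; apply: le_trans (spt _ M0).
have d0 k : (k < M)%N -> 0 <= d k.
  move=> kM; have := tp k kM; have := spt k kM; rewrite -/(g k) => gk pk.
  have gk1 : `|g k.+1| <= t.
    have := kM; rewrite leq_eqVlt => /orP[/eqP->|]; last exact: spt.
    by rewrite gM normr0; apply: t0; apply: leq_ltn_trans kM.
  move: (s0 k) (gS k) gk gk1; rewrite /d /pos /neg !ler_norml.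
  move=> sk gSk /andP[? ?] /andP[? ?].
  by case: (ltP (g k) 0) => h; case: (ltP (- g k.+1) 0) => h'; lra.
exists (fun k l => (l == k)%:R * d k + (l == k.+1)%:R * pos (g k.+1)
           + (k == l.+1)%:R * neg (g k)).
have pick (F : nat -> R) k :
    (k < M)%N -> \sum_(l < M) ((l : nat) == k)%:R * F l = F k.
  move=> kM; rewrite (bigD1 (Ordinal kM))//= eqxx mul1r big1 ?addr0// => i.
  by rewrite -val_eqE/= => /negPf ->; rewrite mul0r.
split.
- by move=> k l kM; rewrite !addr_ge0// mulr_ge0// d0.
- move=> k kM; rewrite !big_split/= (pick (fun=> d k))// dE.
  have -> : \sum_(l < M) ((l : nat) == k.+1)%:R * pos (g k.+1) = pos (g k.+1).
    move: kM; rewrite leq_eqVlt => /orP[/eqP->|kM].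
      by rewrite gM /pos maxxx big1// => i _; rewrite mulr0.
    by rewrite (pick (fun=> pos (g k.+1))).
  have -> : \sum_(l < M) (k == l.+1)%:R * neg (g k) = neg (g k).
    case: k kM => [|k] kM.
      by rewrite g0 /neg oppr0 maxxx big1// => i _; rewrite mulr0.
    rewrite -[RHS](pick (fun=> neg (g k.+1)) k (ltnW kM)).
    by apply: eq_bigr => i _; rewrite eqSS eq_sym.
  by ring.
- move=> l lM; rewrite !big_split/=.
  have -> : \sum_(k < M) (l == k :> nat)%:R * d k = d l.
    by rewrite -[RHS](pick d l lM); apply: eq_bigr => i _; rewrite eq_sym.
  have -> : \sum_(k < M) (l == k.+1)%:R * pos (g k.+1) = pos (g l).
    case: l lM => [|l] lM.
      by rewrite g0 /pos maxxx big1// => i _; rewrite mul0r.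
    rewrite -[RHS](pick (fun k => pos (g k.+1)) l (ltnW lM)).
    by apply: eq_bigr => i _; rewrite eqSS eq_sym.
  have -> : \sum_(k < M) ((k : nat) == l.+1)%:R * neg (g k) = neg (g l.+1).
    move: lM; rewrite leq_eqVlt => /orP[/eqP->|lM].
      rewrite gM /neg oppr0 maxxx big1// => i _.
      by rewrite ltn_eqF// mul0r.
    by rewrite (pick (fun k => neg (g k))).
  by rewrite /d; ring.
- move=> k l; case: (eqVneq l k) => [-> _|lk]; first by rewrite leqnSn.
  case: (eqVneq l k.+1) => [-> _|lk1]; first by rewrite leqnn andbT; lia.
  case: (eqVneq k l.+1) => [-> _|kl1]; first by rewrite leqnn; lia.
  by rewrite !mul0r !addr0 eqxx.
Qed.

(** * Sample frequencies *)

Lemma measure_fin_bigcup_le d (T : measurableType d) (R : realType)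
    (m : {measure set T -> \bar R}) (I : finType) (Q : {pred I})
    (F : I -> set T) (u : I -> \bar R) :
  (forall i, i \in Q -> measurable (F i) /\ (m (F i) <= u i)%E) ->
  measurable (\bigcup_(i in [set` Q]) F i) /\
  (m (\bigcup_(i in [set` Q]) F i) <= \sum_(i in Q) u i)%E.
Proof.
move=> Fu; rewrite bigcup_pred.
apply: (big_ind2 (fun (A : set T) (x : \bar R) => measurable A /\ (m A <= x)%E)).
- by rewrite measure0.
- move=> A x B y [mA Ax] [mB By]; split; first exact: measurableU.
  by apply: le_trans (leeD Ax By); exact: measureU2.
- exact: Fu.
Qed.

Definition hits (n : nat) (Psi T : Type) (X : 'I_n -> Psi -> T) (A : set T)
    (w : Psi) : {set 'I_n} := [set i | X i w \in A].

Section deviation.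
Context (R : realType) d d' (Psi : measurableType d) (T : measurableType d')
  (P : probability Psi R) (mu : probability T R) (n : nat)
  (X : 'I_n -> {RV P >-> T}).
Hypothesis iidX : iid_with_law mu X.

(** Joint independence applied to [A] at the indices in [J] and to its
    complement at the others: the set of indices whose sample falls in [A] has
    the law of a set of Bernoulli successes. *)
Lemma hits_law (A : set T) (J : {set 'I_n}) : measurable A ->
  measurable [set w | hits X A w = J] /\
  P [set w | hits X A w = J] =
    (\prod_i (if i \in J then fine (mu A) else 1 - fine (mu A)))%:E.
Proof.
move=> mA; have [indX lawX] := iidX.
pose B i := if i \in J then A else ~` A.
have mB i : measurable (B i) by rewrite /B; case: ifP => // _; exact: measurableC.
have -> : [set w | hits X A w = J] =
    \bigcap_(i in [set` [set: 'I_n]%SET]) (X i @^-1` B i).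
  apply/seteqP; split => [w /= wJ i _|w wJ].
    rewrite /B -wJ /hits finset.inE /=; case: ifPn => [/set_mem//|/negP h wA].
    exact/h/mem_set.
  apply/setP => i; have := wJ i (finset.in_setT i); rewrite /B /hits finset.inE /=.
  by case: ifP => _ h; [exact: mem_set|exact: memNset].
split.
  apply: fin_bigcap_measurable; first exact: finite_finset.
  by move=> i _; rewrite -[X in measurable X]setTI; exact: measurable_funP.
rewrite indX// -prodEFin; apply: eq_big => [i|i _]; first by rewrite finset.in_setT.
rewrite -[LHS]/(distribution P (X i) (B i)) lawX// /B; case: ifP => _.
  by rewrite fineK// fin_num_measure.
by rewrite probability_setC// EFinB fineK// fin_num_measure.
Qed.

Lemma hits_upper_tail (A : set T) (t : R) : measurable A -> 0 <= t <= 4^-1 ->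
  measurable [set w | n%:R * (fine (mu A) + t) < #|hits X A w|%:R] /\
  (P [set w | (n%:R * (fine (mu A) + t) < #|hits X A w|%:R)%R]
     <= (expR (- (n%:R * t ^+ 2)))%:E)%E.
Proof.
move=> mA t01.
pose many := [pred J : {set 'I_n} | n%:R * (fine (mu A) + t) < #|J|%:R].
have -> : [set w | n%:R * (fine (mu A) + t) < #|hits X A w|%:R] =
    \bigcup_(J in [set` many]) [set w | hits X A w = J].
  apply/seteqP; split => [w wt|w [J /= manyJ wJ]].
    by exists (hits X A w).
  by move: manyJ; rewrite -wJ.
have p01 : 0 <= fine (mu A) <= 1.
  rewrite fine_ge0//= -lee_fin fineK ?fin_num_measure//.
  exact: probability_le1.
have law_le (J : {set 'I_n}) : J \in many -> measurable [set w | hits X A w = J] /\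
    (P [set w | hits X A w = J] <=
     (\prod_i (if i \in J then fine (mu A) else 1 - fine (mu A)))%:E)%E.
  by move=> _; have [mJ ->] := hits_law J mA.
have [mE PE] := measure_fin_bigcup_le law_le; split => //.
apply: le_trans PE _; rewrite sumEFin lee_fin.
exact: binomial_chernoff.
Qed.

Lemma hits_setC (A : set T) w : #|hits X (~` A) w| = (n - #|hits X A w|)%N.
Proof.
have -> : hits X (~` A) w = ~: hits X A w.
  by apply/setP => i; rewrite !finset.inE classical_sets.in_setC.
by rewrite cardsCs finset.setCK card_ord.
Qed.

(** The lower tail for [A] is the upper tail for its complement. *)
Lemma hits_deviation (A : set T) (t : R) : measurable A -> 0 <= t <= 4^-1 ->
  measurable [set w | n%:R * t < `|#|hits X A w|%:R - n%:R * fine (mu A)|] /\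
  (P [set w | (n%:R * t < `|#|hits X A w|%:R - n%:R * fine (mu A)|)%R]
     <= (2 * expR (- (n%:R * t ^+ 2)))%:E)%E.
Proof.
move=> mA t01.
have [mU PU] := hits_upper_tail mA t01.
have [mL PL] := hits_upper_tail (measurableC mA) t01.
have -> : [set w | n%:R * t < `|#|hits X A w|%:R - n%:R * fine (mu A)|] =
  [set w | n%:R * (fine (mu A) + t) < #|hits X A w|%:R] `|`
  [set w | n%:R * (fine (mu (~` A)) + t) < #|hits X (~` A) w|%:R].
  have muC : fine (mu (~` A)) = 1 - fine (mu A).
    by rewrite probability_setC// fineB// fin_num_measure.
  apply/predeqP => w /=; rewrite muC hits_setC natrB; last first.
    by rewrite -[leqRHS]card_ord max_card.
  rewrite ltr_normr; split => [/orP[]|[]] h.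
  - by left; lra.
  - by right; lra.
  - by apply/orP; left; lra.
  - by apply/orP; right; lra.
split; first exact: measurableU.
apply: le_trans (measureU2 _ mU mL) _.
have -> : 2 * expR (- (n%:R * t ^+ 2)) =
    expR (- (n%:R * t ^+ 2)) + expR (- (n%:R * t ^+ 2)) by ring.
by rewrite EFinD leeD.
Qed.
End deviation.

(** * Disintegration along a path of cells *)

Lemma probability_mixture d (T : measurableType d) (R : realType)
    (mu : probability T R) (M : nat) (C : nat -> set T) (w : nat -> R) :
  (forall l, measurable (C l)) -> (forall l, 0 <= w l) ->
  (\sum_(l < M) (w l)%:E * mu (C l) = 1)%E ->
  exists nu : probability T R,
    forall A, nu A = (\sum_(l < M) (w l)%:E * mu (A `&` C l))%E.
Proof.
move=> mC w0 w1.
pose m : {measure set T -> \bar R} :=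
  msum (fun l => mscale (NngNum (w0 l)) (mrestr mu (mC l))) M.
have mT : m setT = 1%E.
  rewrite -w1 /m /= /msum /=.
  by apply: eq_bigr => l _; rewrite /mscale/= /mrestr setTI.
pose nu : probability T R :=
  HB.pack (Measure.sort m) (Measure_isProbability.Build _ _ _ (Measure.sort m) mT).
by exists nu.
Qed.

Lemma measure_level_sum d (T : measurableType d) (R : realType)
    (mu : {measure set T -> \bar R}) (kappa : T -> nat) (A : set T) (k : nat) :
  (forall l, measurable [set x | kappa x = l]) -> measurable A ->
  measurable [set x | (kappa x < k)%N] /\
  mu (A `&` [set x | (kappa x < k)%N]) =
    (\sum_(l < k) mu (A `&` [set x | kappa x = l]))%E.
Proof.
move=> mkappa mA; elim: k => [|k [mk IH]].
  rewrite (_ : [set x | _] = set0) ?setI0 ?measure0 ?big_ord0//.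
  by apply/seteqP; split.
have -> : [set x | (kappa x < k.+1)%N] =
    [set x | (kappa x < k)%N] `|` [set x | kappa x = k].
  apply/predeqP => x /=; rewrite ltnS leq_eqVlt.
  split=> [/orP[/eqP|]|[->|->]]; rewrite ?eqxx ?orbT//.
  - by right.
  - by left.
split; first exact: measurableU.
rewrite setIUr measureU ?big_ord_recr/= ?IH//; [exact: measurableI..|].
by apply/seteqP; split => // x [[_ /= +] [_ /= xk]]; rewrite xk ltnn.
Qed.

(** The deterministic half of the argument.  The cells are the level sets of
    [kappa]; the transport plan [b] between the empirical cell masses [s] and
    the true ones [p] is split evenly among the sample points of each cell, and
    the mass arriving in cell [l] is spread as [mu] restricted to that cell. *)
Lemma path_disintegration (R : realType) (T : pmetricType R)
    (mu : probability (borel T) R) (n : nat) (x : 'I_n -> T) (r : R)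
    (M : nat) (kappa : T -> nat) (t : R) :
  (0 < n)%N -> 0 < t ->
  (forall k, measurable ([set y | kappa y = k] : set (borel T))) ->
  (forall y, (kappa y < M)%N) ->
  (forall k, (k < M)%N ->
     t <= fine (mu ([set y | kappa y = k] : set (borel T)))) ->
  (forall y z, (kappa y <= (kappa z).+1)%N -> (kappa z <= (kappa y).+1)%N ->
     mdist y z <= r) ->
  (forall k, (k < M)%N ->
     `|#|[set i | (kappa (x i) < k)%N]%SET|%:R
       - n%:R * fine (mu ([set y | (kappa y < k)%N] : set (borel T)))|
       <= n%:R * t) ->
  exists nu, ball_disintegration mu x r nu.
Proof.
move=> n0 t0 mkappa kappaM tp adj dev.
pose C k : set (borel T) := [set y | kappa y = k].
pose p k := fine (mu (C k)).
pose s k : R := #|[set i | kappa (x i) == k]%SET|%:R / n%:R.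
have nR : 0 < n%:R :> R by rewrite ltr0n.
have s0 k : 0 <= s k by rewrite divr_ge0.
have muC k : mu (C k) = (p k)%:E by rewrite fineK// fin_num_measure//; exact: mkappa.
have p0 k : 0 <= p k by rewrite fine_ge0.
have p_gt0 k : (k < M)%N -> 0 < p k by move=> kM; apply: lt_le_trans (tp k kM).
have psum k :
    \sum_(j < k) p j = fine (mu ([set y | (kappa y < k)%N] : set (borel T))).
  have [_] := measure_level_sum mu k mkappa
    (measurableT : measurable (setT : set (borel T))).
  rewrite setTI => ->.
  rewrite -[LHS]/(fine (\sum_(j < k) p j)%:E) -sumEFin; congr fine.
  by apply: eq_bigr => l _; rewrite setTI; exact/esym/muC.
have ssum k : \sum_(j < k) s j = #|[set i | (kappa (x i) < k)%N]%SET|%:R / n%:R.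
  rewrite -mulr_suml; congr (_ / _).
  elim: k => [|k IH].
    by rewrite big_ord0 (_ : [set i | _]%SET = finset.set0) ?cards0.
  rewrite big_ord_recr /= IH -natrD; congr (_%:R).
  have -> : [set i | (kappa (x i) < k.+1)%N]%SET =
     [set i | (kappa (x i) < k)%N]%SET :|: [set i | kappa (x i) == k]%SET.
    by apply/setP => i; rewrite !finset.inE ltnS leq_eqVlt orbC.
  rewrite cardsU (_ : _ :&: _ = finset.set0) ?cards0 ?subn0//.
  by apply/setP => i; rewrite !finset.inE; case: ltngtP.
have allM : [set y | (kappa y < M)%N] = setT.
  by apply/seteqP; split => // y _; exact: kappaM.
have sM : \sum_(k < M) s k = 1.
  rewrite ssum (_ : [set i | _]%SET = finset.setT) ?cardsT ?card_ord ?divff ?gt_eqF//.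
  by apply/setP => i; rewrite !finset.inE kappaM.
have pM : \sum_(k < M) p k = 1 by rewrite psum allM probability_setT.
have spt k : (k < M)%N -> `|\sum_(j < k) s j - \sum_(j < k) p j| <= t.
  move=> /dev; rewrite psum ssum => h.
  rewrite -(ler_pM2l nR); apply: le_trans h; rewrite -{1}(gtr0_norm nR) -normrM.
  by rewrite mulrBr mulrCA divff ?gt_eqF// mulr1.
have [b [b0 bs bp badj]] := tridiagonal_transport s0 tp (etrans sM (esym pM)) spt.
(* a point of cell [k] carries the share [1 / (n * s k)] of the plan [b k l];
   the factor [n] normalizes [nu i] to a probability *)
pose w i l := b (kappa (x i)) l / (s (kappa (x i)) * p l).
have w0 i l : 0 <= w i l by rewrite divr_ge0 ?b0// mulr_ge0.
have s_gt0 i : 0 < s (kappa (x i)).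
  rewrite divr_gt0// ltr0n card_gt0.
  by apply/set0Pn; exists i; rewrite finset.inE.
have w1 i : (\sum_(l < M) (w i l)%:E * mu (C l) = 1)%E.
  transitivity ((\sum_(l < M) b (kappa (x i)) l / s (kappa (x i)))%:E).
    rewrite -sumEFin; apply: eq_bigr => l _; rewrite muC -EFinM /w; congr (_%:E).
    by field; rewrite !gt_eqF// p_gt0.
  by rewrite -mulr_suml bs// divff// gt_eqF.
have /choice[nu nuE] := fun i => probability_mixture mkappa (w0 i) (w1 i).
exists nu; split => [i|A mA].
  rewrite nuE -[RHS](w1 i); apply: eq_bigr => l _.
  have [->|wil] := eqVneq (w i l) 0; first by rewrite !mul0e.
  congr (_ * mu _)%E; apply/seteqP; split => [y []//|y /= yl]; split => //.
  have : b (kappa (x i)) l != 0.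
    by apply: contra_neq wil; rewrite /w => ->; rewrite mul0r.
  by move=> /badj; rewrite -yl => /andP[? ?]; exact: adj.
have [_] := measure_level_sum mu M mkappa mA.
rewrite allM setIT => ->.
pose q l := fine (mu (A `&` C l)).
have muq l : mu (A `&` C l) = (q l)%:E.
  rewrite fineK// fin_num_measure//.
  by apply: measurableI => //; exact: mkappa.
transitivity ((n%:R^-1 * \sum_(i < n) \sum_(l < M) w i l * q l)%:E); last first.
  rewrite EFinM -sumEFin; congr (_ * _)%E; apply: eq_bigr => i _.
  by rewrite nuE -sumEFin; apply: eq_bigr => l _; rewrite EFinM -muq.
rewrite exchange_big/= mulr_sumr -sumEFin; apply: eq_bigr => l _.
rewrite [LHS]muq -mulr_suml mulrA; congr (_%:E).
suff -> : \sum_(i < n) w i l = n%:R by rewrite mulVf ?mul1r// gt_eqF.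
rewrite (partition_big (fun i => Ordinal (kappaM (x i))) xpredT)//=.
transitivity (\sum_(k < M) n%:R / p l * b k l); last first.
  by rewrite -mulr_sumr bp// divfK// gt_eqF// p_gt0.
apply: eq_bigr => k _.
transitivity (\sum_(i | kappa (x i) == k) b k l / (s k * p l)).
  by apply: eq_big => // i /eqP ik; rewrite /w -[k]ik.
rewrite sumr_const -[_ *+ _]mulr_natr.
have -> : #|[pred i | kappa (x i) == k]|%:R = n%:R * s k.
  rewrite mulrCA divff ?gt_eqF// mulr1; congr (_%:R).
  by apply: eq_card => i; rewrite finset.inE.
have [sk|sk] := eqVneq (s k) 0; last by field; rewrite sk gt_eqF ?p_gt0.
(* an empty cell has nothing to send *)
have : b k l = 0.
  have := bs k (ltn_ord k); rewrite sk => /psumr_eq0P; apply => // l' _.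
  exact: b0.
by move=> ->; rewrite sk !mulr0.
Qed.

(** The probabilistic half: the good event excludes the [M] deviations of the
    frequencies of [kappa < k], hence the union bound in the hypothesis on
    [eps]. *)
Lemma path_partition_disintegrable (R : realType) (T : pmetricType R)
    (mu : probability (borel T) R) (n M : nat) (kappa : T -> nat) (t r eps : R) :
  (0 < n)%N -> 0 < t <= 4^-1 ->
  (forall k, measurable ([set y | kappa y = k] : set (borel T))) ->
  (forall y, (kappa y < M)%N) ->
  (forall k, (k < M)%N ->
     t <= fine (mu ([set y | kappa y = k] : set (borel T)))) ->
  (forall y z, (kappa y <= (kappa z).+1)%N -> (kappa z <= (kappa y).+1)%N ->
     mdist y z <= r) ->
  M%:R * (2 * expR (- (n%:R * t ^+ 2))) <= eps ->
  disintegrable mu n eps r.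
Proof.
move=> n0 /andP[t0 t4] mkappa kappaM tp adj Meps d Psi P X iidX.
pose A k : set (borel T) := [set y | (kappa y < k)%N].
have mA k : measurable (A k).
  by have [] := measure_level_sum mu k mkappa
    (measurableT : measurable (setT : set (borel T))).
pose bad k := [set w |
  n%:R * t < `|#|hits X (A k) w|%:R - n%:R * fine (mu (A k))|].
have t04 : 0 <= t <= 4^-1 by rewrite ltW.
have badP (k : 'I_M) : k \in predT -> measurable (bad k) /\
    (P (bad k) <= (2 * expR (- (n%:R * t ^+ 2)))%:E)%E.
  by move=> _; exact: (hits_deviation iidX).
have [mB PB] := measure_fin_bigcup_le badP.
exists (~` \bigcup_(k in [set` predT : {pred 'I_M}]) bad k); split.
- exact: measurableC.
- rewrite probability_setC// EFinB leeB//.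
  apply: le_trans PB _.
  by rewrite sumEFin lee_fin sumr_const -[leLHS]mulr_natl card_ord.
- move=> w nbad; apply: (path_disintegration n0 t0 mkappa kappaM tp adj) => k kM.
  rewrite leNgt; apply/negP => dev; apply: nbad; exists (Ordinal kM) => //=.
  rewrite /bad /= (_ : hits X (A k) w = [set i | (kappa (X i w) < k)%N]%SET)//.
  apply/setP => i; rewrite !finset.inE.
  by apply/idP/idP => [/set_mem//|]; exact: mem_set.
Qed.

(** * A snake through the grid *)

Section snake.
Local Open Scope nat_scope.

(** Boustrophedon numbering of the grid [m ^ D]: the last coordinate is the
    leading digit in base [m], and the layers where it is odd are traversed
    backwards. *)
Fixpoint snake (m D : nat) (v : nat -> nat) : nat :=
  if D is D'.+1 then
    v D' * m ^ D' +
    (if odd (v D') then (m ^ D').-1 - snake m D' v else snake m D' v)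
  else 0.

Lemma eq_snake (m D : nat) (v v' : nat -> nat) :
  (forall j, j < D -> v j = v' j) -> snake m D v = snake m D v'.
Proof.
elim: D => //= D IH vv'; rewrite vv'// IH// => j jD.
by apply: vv'; rewrite ltnS ltnW.
Qed.

Lemma snake_lt (m D : nat) (v : nat -> nat) :
  (forall j, j < D -> v j < m) -> snake m D v < m ^ D.
Proof.
elim: D => //= D IH vm.
have := vm D (leqnn _); have : snake m D v < m ^ D.
  by apply: IH => j jD; apply: vm; rewrite ltnS ltnW.
by rewrite expnS; case: ifP; nia.
Qed.

(** Either there is no carry, or the lower digit jumps between its extreme
    values. *)
Lemma adjacent_digits (N q a q' a' : nat) : a < N -> a' < N ->
  q * N + a <= (q' * N + a').+1 -> q' * N + a' <= (q * N + a).+1 ->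
  [\/ [/\ q = q', a <= a'.+1 & a' <= a.+1],
      [/\ q' = q.+1, a = N.-1 & a' = 0] |
      [/\ q = q'.+1, a = 0 & a' = N.-1]].
Proof.
move=> aN a'N h h'; case: (ltngtP q q') => qq'.
- by apply: Or32; split; nia.
- by apply: Or33; split; nia.
- by apply: Or31; split; nia.
Qed.

Lemma snake_inj (m D : nat) (v v' : nat -> nat) :
  (forall j, j < D -> v j < m) -> (forall j, j < D -> v' j < m) ->
  snake m D v = snake m D v' -> forall j, j < D -> v j = v' j.
Proof.
elim: D => //= D IH vm v'm e.
have vm' j : j < D -> v j < m by move=> jD; apply: vm; rewrite ltnS ltnW.
have v'm' j : j < D -> v' j < m by move=> jD; apply: v'm; rewrite ltnS ltnW.
have [sv sv'] := (snake_lt vm', snake_lt v'm').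
have vD : v D = v' D.
  by move: e; case: ifP => _; case: ifP => _; nia.
move: e; rewrite vD => e j; rewrite ltnS leq_eqVlt => /orP[/eqP->//|].
by apply: IH => //; move: e; case: ifP; lia.
Qed.

(** When the leading coordinate changes, the lower digit jumps from one extreme
    to the other; as the two layers are traversed in opposite directions, the
    remaining coordinates are the same. *)
Lemma snake_adjacent (m D : nat) (v v' : nat -> nat) :
  (forall j, j < D -> v j < m) -> (forall j, j < D -> v' j < m) ->
  snake m D v <= (snake m D v').+1 -> snake m D v' <= (snake m D v).+1 ->
  forall j, j < D -> v j <= (v' j).+1 /\ v' j <= (v j).+1.
Proof.
elim: D => //= D IH vm v'm e e'.
have vm' j : j < D -> v j < m by move=> jD; apply: vm; rewrite ltnS ltnW.
have v'm' j : j < D -> v' j < m by move=> jD; apply: v'm; rewrite ltnS ltnW.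
have [sv sv'] := (snake_lt vm', snake_lt v'm').
set f := fun b s => if b then (m ^ D).-1 - s else s.
have f_lt b s : s < m ^ D -> f b s < m ^ D by rewrite /f; case: b; lia.
case: (adjacent_digits (f_lt (odd (v D)) _ sv) (f_lt (odd (v' D)) _ sv') e e').
- move=> [vD]; rewrite /f vD => h h' j; rewrite ltnS leq_eqVlt => /orP[/eqP->|].
    by rewrite vD.
  by apply: IH => //; move: h h'; case: ifP; lia.
- move=> [v'D]; rewrite /f v'D /= => h h' j; rewrite ltnS leq_eqVlt => /orP[/eqP->|jD].
    by rewrite v'D; lia.
  suff /(snake_inj vm' v'm') /(_ _ jD) -> : snake m D v = snake m D v'
    by rewrite leqnSn.
  by clear e e'; move: h h'; case: (odd (v D)) => /=; lia.
- move=> [vD]; rewrite /f vD /= => h h' j; rewrite ltnS leq_eqVlt => /orP[/eqP->|jD].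
    by rewrite vD; lia.
  suff /(snake_inj vm' v'm') /(_ _ jD) -> : snake m D v = snake m D v'
    by rewrite leqnSn.
  by clear e e'; move: h h'; case: (odd (v' D)) => /=; lia.
Qed.

Lemma snake_surj (m D l : nat) : l < m ^ D ->
  exists v : nat -> nat, (forall j, j < D -> v j < m) /\ snake m D v = l.
Proof.
elim: D l => [|D IH] l; first by rewrite expn0 ltnS leqn0 => /eqP->; exists (fun=> 0).
rewrite expnS => lm.
have N0 : 0 < m ^ D by case: (m ^ D) lm => //; rewrite muln0.
pose q := l %/ m ^ D; pose a := l %% m ^ D.
have aN : a < m ^ D by rewrite ltn_mod.
have qm : q < m by rewrite ltn_divLR.
have [|v [vm va]] := IH (if odd q then (m ^ D).-1 - a else a); first by case: ifP; lia.
exists (fun j => if j < D then v j else q); split => [j _|/=].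
  by case: ifP => // /vm.
rewrite ltnn (@eq_snake m D _ v) ?va; last by move=> j ->.
rewrite [RHS](divn_eq l (m ^ D)) -/q -/a; congr (_ + _).
by case: (odd q) => //; move: aN; clear; lia.
Qed.

End snake.

(** * The unit cube *)

Section unit_cube_geometry.
Context (R : realType) (D : nat).
Local Notation cube := (unit_cube R D).

Lemma cube_coord_itv (x : cube) (j : 'I_D) : 0 <= val x ord0 j <= 1.
Proof. by have := valP x; rewrite inE => /(_ j). Qed.

Lemma continuous_cube_coord (j : 'I_D) :
  continuous (fun x : cube => val x ord0 j).
Proof.
have cval : continuous (fun x : cube => val x) by apply: initial_continuous.
by move=> x; apply: (@continuous_comp _ _ _ (fun x : cube => val x)
  (fun M : 'rV[R]_D => M ord0 j)); [exact: cval|exact: coord_continuous].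
Qed.

Lemma measurable_cube_coord (j : 'I_D) (a b : R) :
  measurable ([set x : cube | a <= val x ord0 j <= b] : set (borel cube)).
Proof.
rewrite -[X in measurable X]setCK; apply: measurableC; apply: sub_sigma_algebra.
rewrite openC (_ : [set x : cube | _] =
    (fun x : cube => val x ord0 j) @^-1` `[a, b]%classic).
  apply: preimage_closed; last exact: interval_closed.
  by move=> x _; exact: continuous_cube_coord.
by apply/seteqP; split => x; rewrite /= in_itv.
Qed.

Lemma mdist_cube_le (x y : cube) (r : R) : 0 <= r ->
  (forall j, `|val x ord0 j - val y ord0 j| <= r) -> mdist x y <= r.
Proof.
move=> r0 xyr; rewrite -[mdist x y]/(mx_norm (val x - val y)) mx_normrE.
by apply: bigmax_le => // -[i j] _ /=; rewrite ord1 !mxE.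
Qed.

Lemma measurable_cube_box (a b : 'I_D -> R) :
  measurable ([set x : cube | forall j, a j <= val x ord0 j <= b j] : set (borel cube)).
Proof.
rewrite (_ : [set x : cube | _] =
    \bigcap_j [set x : cube | a j <= val x ord0 j <= b j]).
  apply: fin_bigcap_measurable => [|j _]; first exact: finite_finset.
  exact: measurable_cube_coord.
by apply/seteqP; split => [x xab j _|x xab j]; exact: xab.
Qed.

Lemma lebesgue_cube_box (a b : 'I_D -> R) :
  (forall j, [/\ 0 <= a j, a j <= b j & b j <= 1]) ->
  lebesgue_cube ([set x : cube | forall j, a j <= val x ord0 j <= b j] : set (borel cube))
  = (\prod_(j < D) (b j - a j))%:E.
Proof.
move=> ab; rewrite -lebesgue_rV_box; last by move=> j; have [] := ab j.
rewrite /lebesgue_cube; congr (lebesgue_rV _); apply/seteqP; split.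
  by move=> _ [x xab <-].
move=> y yab; have ycube : cube_set R D y.
  move=> j; have [a0 _ b1] := ab j; have /andP[ay yb] := yab j.
  by rewrite (le_trans a0 ay) (le_trans yb b1).
by exists (exist (fun x => x \in cube_set R D) y (mem_set ycube)).
Qed.

Lemma density_lower_bound (mu : probability (borel cube) R)
    (f : borel cube -> R) (c : R) (A : set (borel cube)) :
  0 <= c -> has_density mu f -> (forall x, c <= f x) -> measurable A ->
  (c%:E * lebesgue_cube A <= mu A)%E.
Proof.
move=> c0 [mf muE] cf mA; rewrite muE// -(integral_cst _ mA).
apply: ge0_le_integral => //.
- by apply/measurable_realfun.measurable_EFinP; apply: measurable_funS mf.
- by move=> x _; rewrite lee_fin.
Qed.

End unit_cube_geometry.

(** The minimum puts the endpoint [x = 1] into the last interval. *)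
Definition cell_coord (R : realType) (m : nat) (x : R) : nat :=
  minn (Num.truncn (m%:R * x)) m.-1.

Lemma cell_coord_lt (R : realType) (m : nat) (x : R) : (0 < m)%N ->
  (cell_coord m x < m)%N.
Proof. by move=> m0; rewrite /cell_coord gtn_min prednK// leqnn orbT. Qed.

Lemma cell_coord_itv (R : realType) (m : nat) (x : R) :
  (0 < m)%N -> 0 <= x <= 1 ->
  (cell_coord m x)%:R <= m%:R * x <= (cell_coord m x).+1%:R.
Proof.
move=> m0 /andP[x0 x1].
have mx0 : 0 <= m%:R * x by rewrite mulr_ge0.
have /andP[lo up] := truncn_itv mx0.
rewrite /cell_coord; case: (leqP (Num.truncn (m%:R * x)) m.-1) => h.
  by rewrite lo ltW.
rewrite prednK// (le_trans _ lo) ?ler_nat 1?ltnW//=.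
by rewrite ler_piMr.
Qed.

Lemma cell_coordP (R : realType) (m v : nat) (x : R) : (v < m)%N ->
  v%:R <= m%:R * x < v.+1%:R -> cell_coord m x = v.
Proof.
move=> vm vx; rewrite /cell_coord (truncn_def vx).
by apply/minn_idPl; rewrite -ltnS prednK// (leq_trans _ vm).
Qed.

Lemma leq_cell_coord (R : realType) (m k : nat) (x : R) : 0 <= x ->
  (k <= cell_coord m x)%N = (k <= m.-1)%N && (k%:R <= m%:R * x).
Proof.
move=> x0; rewrite /cell_coord leq_min andbC; congr (_ && _).
have mx0 : 0 <= m%:R * x by rewrite mulr_ge0.
by rewrite truncn_ge_nat.
Qed.

(** The statement is for an arbitrary set [B] of values because the induction
    replaces [B] by its preimage under the last step of [snake]. *)
Lemma measurable_snake d (T : measurableType d) (m D : nat) (v : T -> nat -> nat)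
    (B : set nat) :
  (forall j a, (j < D)%N -> measurable [set x | v x j = a]) ->
  measurable [set x | B (snake m D (v x))].
Proof.
elim: D B => [|D IH] B mv /=.
  have [B0|nB0] := pselect (B 0%N).
    by rewrite (_ : [set x | _] = setT)//; apply/seteqP; split.
  by rewrite (_ : [set x | _] = set0)//; apply/seteqP; split.
have -> : [set x | B (v x D * m ^ D + (if odd (v x D)
      then (m ^ D).-1 - snake m D (v x) else snake m D (v x)))%N] =
  \bigcup_a ([set x | v x D = a] `&` [set x | [set s | B (a * m ^ D + (if odd a
      then (m ^ D).-1 - s else s))%N] (snake m D (v x))]).
  apply/seteqP; split => [x Bx|x [a _ [/= <-]]]//.
  by exists (v x D).
apply: bigcupT_measurable => a; apply: measurableI; first exact: mv.
by apply: IH => j b jD; apply: mv; rewrite ltnS ltnW.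
Qed.

(** * The path of cells in the cube *)

Section cube_path.
Context (R : realType) (D : nat) (m : nat).
Hypothesis m0 : (0 < m)%N.
Local Notation cube := (unit_cube R D.+1).

Definition cube_cell (x : cube) (j : nat) : nat :=
  cell_coord m (val x ord0 (inord j)).

Definition cube_index (x : cube) : nat := snake m D.+1 (cube_cell x).

Lemma cube_index_lt x : (cube_index x < m ^ D.+1)%N.
Proof. by apply: snake_lt => j _; exact: cell_coord_lt. Qed.

Lemma measurable_cube_index (k : nat) :
  measurable ([set x | cube_index x = k] : set (borel cube)).
Proof.
apply: (@measurable_snake _ (borel cube) m D.+1 cube_cell [set k]) => j a _.
(* the level sets of a coordinate are differences of closed half-spaces *)
pose H b : set (borel cube) := [set x : cube | (b <= cube_cell x j)%N].
suff mH b : measurable (H b).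
  rewrite (_ : [set x | _] = H a `\` H a.+1); first exact: measurableD.
  apply/seteqP; split => [x /= <-|x [/= ax /negP]]; first
    by split; rewrite /H/= ?ltnn.
  by rewrite -leqNgt => xa; apply/eqP; rewrite eqn_leq xa.
case: (leqP b m.-1) => bm; last first.
  rewrite (_ : H b = set0)//; apply/seteqP; split => // x.
  have /andP[x0 _] := cube_coord_itv x (inord j).
  by rewrite /H /= /cube_cell (leq_cell_coord _ _ x0) leqNgt bm.
rewrite (_ : H b = [set x : cube | b%:R / m%:R <= val x ord0 (inord j) <= 1]).
  exact: measurable_cube_coord.
apply/predeqP => x; have /andP[x0 x1] := cube_coord_itv x (inord j).
by rewrite /H /= /cube_cell (leq_cell_coord _ _ x0) bm x1 andbT
  ler_pdivrMr ?ltr0n// mulrC.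
Qed.

Lemma cube_index_adjacent (x y : cube) :
  (cube_index x <= (cube_index y).+1)%N ->
  (cube_index y <= (cube_index x).+1)%N ->
  mdist x y <= 2 / m%:R.
Proof.
move=> xy yx.
have mR : 0 < m%:R :> R by rewrite ltr0n.
apply: mdist_cube_le => [|j]; first by rewrite divr_ge0.
have lt_cell z i : (i < D.+1)%N -> (cube_cell z i < m)%N.
  by move=> _; exact: cell_coord_lt.
have [] := snake_adjacent (lt_cell x) (lt_cell y) xy yx (ltn_ord j).
rewrite /cube_cell inord_val => cxy cyx.
have /andP[x1 x2] := cell_coord_itv m0 (cube_coord_itv x j).
have /andP[y1 y2] := cell_coord_itv m0 (cube_coord_itv y j).
rewrite ler_pdivlMr// -(gtr0_norm mR) -normrM mulrBl ler_norml ![_ * m%:R]mulrC.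
move: cxy cyx; rewrite -!(ler_nat R) -!natr1 in x2 y2 *.
by move=> cxy cyx; apply/andP; split; lra.
Qed.

(** A closed box with side [h < 1 / m] at the lower corner of a cell lies inside
    it and has a known volume, whatever boundary faces the cell contains. *)
Lemma lebesgue_cube_index_ge (h : R) (k : nat) :
  0 <= h -> h * m%:R < 1 -> (k < m ^ D.+1)%N ->
  ((h ^+ D.+1)%:E <=
   lebesgue_cube ([set x | cube_index x = k] : set (borel cube)))%E.
Proof.
move=> h0 hm /snake_surj[v [vm vk]].
have mR : 0 < m%:R :> R by rewrite ltr0n.
pose a (j : 'I_D.+1) : R := (v j)%:R / m%:R.
have ab j : [/\ 0 <= a j, a j <= a j + h & a j + h <= 1].
  split; [exact: divr_ge0|by rewrite lerDl|].
  rewrite -(ler_pM2r mR) mulrDl mul1r divfK ?gt_eqF//.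
  apply: le_trans (_ : (v j).+1%:R <= _); last by rewrite ler_nat vm.
  by rewrite -natr1 lerD2l ltW.
have := lebesgue_cube_box ab.
rewrite (eq_bigr (fun=> h)) => [|j _]; last by rewrite addrC addKr.
rewrite prodr_const card_ord => <-.
apply: le_measure; rewrite ?inE; [exact: measurable_cube_box|exact: measurable_cube_index|].
move=> x /= xab; rewrite /cube_index -vk; apply: eq_snake => j jD.
apply: cell_coordP; first exact: vm.
have := xab (inord j); rewrite /a inordK// => /andP[lo up].
rewrite mulrC -ler_pdivrMr// lo -natr1 /=.
apply: (@le_lt_trans _ _ (((v j)%:R / m%:R + h) * m%:R)); first by rewrite ler_pM2r.
by rewrite mulrDl divfK ?gt_eqF// ltrD2l.
Qed.

End cube_path.

Lemma grid_disintegrable (R : realType) (D m n : nat)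
    (mu : probability (borel (unit_cube R D.+1)) R)
    (f : borel (unit_cube R D.+1) -> R) (c h t r eps : R) :
  (0 < n)%N -> (0 < m)%N -> 0 <= c -> has_density mu f ->
  (forall x, c <= f x) -> 0 <= h -> h * m%:R < 1 -> 2 / m%:R <= r ->
  0 < t <= 4^-1 -> t <= c * h ^+ D.+1 ->
  (m ^ D.+1)%:R * (2 * expR (- (n%:R * t ^+ 2))) <= eps ->
  disintegrable mu n eps r.
Proof.
move=> n0 m0 c0 muf cf h0 hm mr t04 th Meps.
apply: (@path_partition_disintegrable _ _ _ _ _ (@cube_index R D m) _ _ _ n0 t04
  _ _ _ _ Meps).
- by move=> k; exact: measurable_cube_index.
- by move=> x; exact: cube_index_lt.
- move=> k kM; apply: le_trans th _.
  have mk := @measurable_cube_index R D m m0 k.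
  rewrite -lee_fin fineK; last by rewrite fin_num_measure//; apply: mk.
  have := density_lower_bound c0 muf cf mk.
  apply: le_trans.
  by rewrite EFinM lee_wpmul2l ?lee_fin//; exact: lebesgue_cube_index_ge.
- by move=> x y xy yx; apply: le_trans mr; exact: cube_index_adjacent.
Qed.

Lemma disintegrable_large_radius (R : realType) (D n : nat)
    (mu : probability (borel (unit_cube R D)) R) (eps r : R) :
  (0 < n)%N -> 0 <= eps -> 1 <= r -> disintegrable mu n eps r.
Proof.
move=> n0 eps0 r1 d Psi P X _; exists setT; split => //.
  by rewrite probability_setT lee_fin gerBl.
move=> w _; exists (fun=> mu); split => [i|A mA].
  rewrite -(@probability_setT _ _ _ mu); congr (mu _); apply/seteqP; split => // y _.
  apply: le_trans r1; apply: mdist_cube_le => // j.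
  have /andP[a0 a1] := cube_coord_itv (X i w) j.
  have /andP[b0 b1] := cube_coord_itv y j.
  by rewrite ler_norml; apply/andP; split; lra.
rewrite -[mu A]fineK ?fin_num_measure// sumEFin sumr_const card_ord -EFinM.
by rewrite -[X in _ * X]mulr_natl mulKf// pnatr_eq0 -lt0n.
Qed.

(** * Choice of the parameters *)

Lemma disintegration_radius_exp (R : realType) (D : nat) (c alpha : R) (n : nat) :
  0 < c -> 0 < alpha -> (0 < n)%N ->
  disintegration_radius D.+1 c alpha n ^+ D.+1 =
  c^-1 * (4 * 3 ^+ D) * Num.sqrt ((2 + alpha) * (ln n%:R / n%:R)).
Proof.
move=> c0 a0 n0.
have D0 : D.+1%:R != 0 :> R by rewrite pnatr_eq0.
have ln0 : 0 <= ln n%:R / n%:R :> R by rewrite divr_ge0// ln_ge0// ler1n.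
have a2 : 0 <= 2 + alpha by lra.
have powD x y : (x `^ y) ^+ D.+1 = x `^ (y * D.+1%:R) :> R.
  by rewrite powRrM powR_mulrn// powR_ge0.
have half : (2 * D.+1%:R)^-1 * D.+1%:R = 2^-1 :> R by field.
rewrite /disintegration_radius !exprMn !powD half mulNr mulVf//.
rewrite powR_inv1 ?ltW// powRr1; last by rewrite mulr_ge0// exprn_ge0.
by rewrite subn1 /= !powR12_sqrt// (sqrtrM _ a2) !mulrA.
Qed.

(** Reduces to [expR (1 / 2) <= 2], which follows from
    [1 - 1 / 2 <= expR (- 1 / 2)]. *)
Lemma ln_nat_ge_half (R : realType) (n : nat) : (2 <= n)%N -> 2^-1 <= ln n%:R :> R.
Proof.
move=> n2; have n0 : 0 < n%:R :> R by rewrite ltr0n; lia.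
rewrite -ler_expR lnK ?posrE//; apply: (@le_trans _ _ 2); last by rewrite ler_nat.
have e0 := expR_gt0 (2^-1 : R).
have := expR_ge1Dx (- 2^-1 : R); rewrite expRN => h.
rewrite -[leLHS]invrK -[leRHS]invrK lef_pV2 ?posrE ?invr_gt0//.
by apply: le_trans h; lra.
Qed.

Theorem theorem4p14 (R : realType) (D : nat) (c C alpha : R) :
  (1 <= D)%N -> 0 < c -> c <= C -> 0 < alpha ->
  exists n0 : nat,
    forall (mu : probability (borel (unit_cube R D)) R)
           (f : borel (unit_cube R D) -> R),
      has_density mu f ->
      (forall x, c <= f x <= C) ->
      forall n : nat, (n0 <= n)%N ->
        disintegrable mu n (n%:R `^ (- alpha)) (disintegration_radius D c alpha n).
Proof.
case: D => // D _ c0 _ a0; exists 2%N => mu f muf fcC n n2.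
have n0 : (0 < n)%N by lia.
have nR : 0 < n%:R :> R by rewrite ltr0n.
set r := disintegration_radius _ _ _ _.
have [r1|r1] := leP 1 r; first
  exact: disintegrable_large_radius (powR_ge0 _ _) r1.
have cf x : c <= f x by have /andP[] := fcC x.
have c1 : c <= 1.
  have := density_lower_bound (ltW c0) muf cf measurableT.
  by rewrite lebesgue_cubeT mule1 probability_setT lee_fin.
have lnn := @ln_nat_ge_half R n n2.
have ln0 : 0 < ln n%:R :> R by lra.
pose t := Num.sqrt ((2 + alpha) * (ln n%:R / n%:R)).
have t2 : n%:R * t ^+ 2 = (2 + alpha) * ln n%:R.
  rewrite sqr_sqrtr; last by rewrite mulr_ge0 ?divr_ge0//; lra.
  by field; rewrite gt_eqF.
have t0 : 0 < t by rewrite sqrtr_gt0 mulr_gt0 ?divr_gt0//; lra.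
have rD : r ^+ D.+1 = c^-1 * (4 * 3 ^+ D) * t by exact: disintegration_radius_exp.
have r0 : 0 < r.
  have a2 : 0 < 2 + alpha by lra.
  by rewrite !mulr_gt0// powR_gt0// ?divr_gt0// mulr_gt0// exprn_gt0.
have hD : c * (r / 3) ^+ D.+1 = 4 / 3 * t.
  rewrite exprMn rD exprVn exprS.
  by field; rewrite ?expf_neq0// ?gt_eqF ?exprn_gt0.
(* [2 / r < m <= 2 / r + 1 < 3 / r], so the cells have side between [r / 3] and [r / 2] *)
pose m := (Num.truncn (2 / r)).+1.
have /andP[ml mu'] := truncn_itv (divr_ge0 (ler0n R 2) (ltW r0)).
have mr : 2 / m%:R <= r by rewrite ler_pdivrMr ?ltr0n// mulrC -ler_pdivrMr// ltW.
have m3 : (3 <= m)%N.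
  rewrite -(ltr_nat R); apply: lt_trans mu'.
  by rewrite ltr_pdivlMr//; lra.
have hm : r / 3 * m%:R < 1.
  have : (Num.truncn (2 / r))%:R * r <= 2 by rewrite -ler_pdivlMr.
  by rewrite /m -natr1; lra.
have mM : (m <= m ^ D.+1)%N by rewrite expnS leq_pmulr// expn_gt0.
(* the volume of the grid of boxes of side [r / 3] is at most 1, and [c <= 1] *)
have Mt : (m ^ D.+1)%:R * (4 / 3 * t) <= 1.
  have rm0 : 0 <= r / 3 * m%:R by rewrite mulr_ge0// divr_ge0// ltW.
  rewrite -hD natrX mulrCA -exprMn [m%:R * _]mulrC.
  by apply: mulr_ile1; [exact: ltW|exact: exprn_ge0|exact: c1|exact/exprn_ile1/ltW].
have M3 : 3 <= (m ^ D.+1)%:R :> R by rewrite ler_nat (leq_trans m3).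
(* three cells already have mass at least [4 * t] in total *)
have t4 : t <= 4^-1 by nra.
apply: (grid_disintegrable (m := m) n0 _ (ltW c0) muf cf (h := r / 3) (t := t)) => //.
- by rewrite divr_ge0// ltW.
- by rewrite t0.
- by rewrite hD; lra.
(* from [M * t <= 1 <= n * t ^+ 2] *)
have M2 : (m ^ D.+1)%:R ^+ 2 <= n%:R :> R.
  have : 1 <= n%:R * t ^+ 2 by rewrite t2; nra.
  have : (m ^ D.+1)%:R * t <= 1 by nra.
  have := ler0n R (m ^ D.+1).
  set M := _%:R => M0 Mt1 nt.
  have t2_gt0 : 0 < t ^+ 2 by rewrite exprn_gt0.
  rewrite -(ler_pM2r t2_gt0) -exprMn; apply: le_trans nt.
  by rewrite exprn_ile1// mulr_ge0// ltW.
have Mn : 2 * (m ^ D.+1)%:R <= n%:R ^+ 2 :> R.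
  have : 2 <= n%:R :> R by rewrite ler_nat.
  by move: M2 M3; set M : R := (m ^ D.+1)%:R; nra.
rewrite t2 /powR gt_eqF// mulrCA mulrA.
have -> : - ((2 + alpha) * ln n%:R) = - alpha * ln n%:R - 2%:R * ln n%:R :> R by ring.
rewrite expRB expRM_natl lnK ?posrE// mulrCA -[leRHS]mulr1.
by rewrite ler_wpM2l ?expR_ge0// ler_pdivrMr ?exprn_gt0// mul1r.
Qed.
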